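(* For every integer $n\ge 3$, $$|\mathcal{M}_2(P(n))|=\begin{cases}1 & \text{if } n=4,\\[4pt] \displaystyle\sum_{\substack{0\le l\le \lfloor n/3\rfloor\\ n-3l\equiv 0\ (\mathrm{mod}\ 4)}} \frac{n}{\,l+\frac{n-3l}{4}\,}\binom{l+\frac{n-3l}{4}}{l} & \text{otherwise.}\end{cases}$$
   Context: For $n\ge 3$, $P(n)=P(n,2)$ is the simple graph with vertex set $\{u_i,v_i:0\le i\le n-1\}$ and edge set $\{u_iu_{i+2},\,u_iv_i,\,v_iv_{i+1}:0\le i\le n-1\}$, subscripts modulo $n$. The edges $u_iv_i$ are called spokes. For $n\neq 4$, $\mathcal{M}_2(P(n))$ is the set of perfect matchings $M$ of $P(n)$ such that either (i) $M$ contains at least one spoke, and for any two (cyclically) consecutive spokes $u_iv_i,u_jv_j$ of $M$ the number of spokes $u_kv_k$ of $P(n)$ strictly between them, $j-i-1$ (with $j$ taken as the representative in $(i,i+n]$), is $\equiv 2\pmod 4$ (if $M$ has exactly one spoke $u_iv_i$, it is regarded as two consecutive spokes with $j=i+n$, so the number is $n-1$); or (ii) $M$ contains no spoke, $4\mid n$, and for some $i$, $M=\bigcup_{k=0}^{n/4-1}\{u_{i+4k}u_{i+4k+2},\,u_{i+4k+1}u_{i+4k+3},\,v_{i+4k+1}v_{i+4k+2},\,v_{i+4k+3}v_{i+4k+4}\}$. For $n=4$, $\mathcal{M}_2(P(4))$ consists of the single perfect matching $\{u_0u_2,u_1u_3,v_1v_2,v_3v_0\}$. *)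

(* Defs.v *)
From HB Require Import structures.
From mathcomp Require Import all_boot all_order all_algebra.

Set Implicit Arguments.
Unset Strict Implicit.
Unset Printing Implicit Defensive.

Import GRing.Theory.
Local Open Scope ring_scope.

Section PerfectMatching.
Variable V : finType.

(* A simple graph on V is given by its set of edges, which are 2-subsets of V. *)
Definition perfect_matching (E M : {set {set V}}) : bool :=
  [&& M \subset E, trivIset M & cover M == [set: V]].

End PerfectMatching.

(* Subscripts modulo n are elements of 'Z_n, which has n elements only for     *)
(* n > 1; all definitions below are meant for n >= 3.                          *)
Definition vertex (n : nat) : finType := ('Z_n + 'Z_n)%type.

Section GeneralizedPetersen.
Variable n : nat.
Implicit Types (i : 'Z_n) (M : {set {set vertex n}}).

Definition u i : vertex n := inl i.
Definition v i : vertex n := inr i.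

Definition uu i : {set vertex n} := [set u i; u (i + 2)].
Definition spoke i : {set vertex n} := [set u i; v i].
Definition vv i : {set vertex n} := [set v i; v (i + 1)].

Definition petersen2 : {set {set vertex n}} :=
  [set uu i | i in 'Z_n] :|: [set spoke i | i in 'Z_n]
    :|: [set vv i | i in 'Z_n].

(* M contains the spokes at i and at j = i + k + 1, and none of the k spokes   *)
(* of the graph strictly between them.  For k = n - 1 we have j = i, which     *)
(* happens exactly when the spoke at i is the only one in M.                   *)
Definition consecutive_spokes M i (k : nat) : bool :=
  [&& spoke i \in M, spoke (i + k.+1%:R) \in M
    & [forall e : 'I_k, spoke (i + e.+1%:R) \notin M]].

Definition spoke_type M : bool :=
  [exists i, spoke i \in M] &&
  [forall i, forall k : 'I_n,
     consecutive_spokes M i k ==> (k == 2 %[mod 4])%N].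

Definition spokeless_matching i : {set {set vertex n}} :=
  \bigcup_(k < n %/ 4)
    [set [set u (i + (4 * k)%:R); u (i + (4 * k + 2)%:R)];
         [set u (i + (4 * k + 1)%:R); u (i + (4 * k + 3)%:R)];
         [set v (i + (4 * k + 1)%:R); v (i + (4 * k + 2)%:R)];
         [set v (i + (4 * k + 3)%:R); v (i + (4 * k + 4)%:R)]].

Definition spokeless_type M : bool :=
  [&& [forall i, spoke i \notin M], (4 %| n)%N
    & [exists i, M == spokeless_matching i]].

Definition M2 : {set {set {set vertex n}}} :=
  [set M | perfect_matching petersen2 M &
     if (n == 4)%N then
       M == [set [set u 0; u 2]; [set u 1; u 3]; [set v 1; v 2]; [set v 3; v 0]]
     else spoke_type M || spokeless_type M].

End GeneralizedPetersen.

(* Main.v *)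
Require Import Defs.
From HB Require Import structures.
From mathcomp Require Import all_boot all_order all_algebra.
From mathcomp Require Import zify ring lra.

Set Implicit Arguments.
Unset Strict Implicit.
Unset Printing Implicit Defensive.

(** Label the index [i] by the pair [(uu i \in M, vv i \in M)], read as a binary
    digit [0], [1], [2] or [3].  Every vertex being covered exactly once, the
    labels determine a perfect matching [M] when [n <> 4], and [M] belongs to
    [M2 n] iff its labels, read around the cycle, form a closed walk with arcs
    0 -> 1 -> 2 -> 3 -> 0 and 2 -> 0; the spokes of [M] are at the ends of the
    arcs 2 -> 0.  Such walks cut the cycle into pieces of length 3 (one for each
    spoke) and 4, so that spokeless matchings need no separate count.  If [A] is
    the adjacency matrix of these arcs then [A ^+ 4 = A + 1], hence the number
    [c n] of closed walks satisfies [c (n + 4) = c n + c (n + 1)], and the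
    right-hand side of the formula obeys the same recurrence by Pascal's rule. *)

Import GRing.Theory Num.Theory.
Local Open Scope ring_scope.

(** * Residues modulo 4 as labels *)

(** The last two binary digits of [e], high digit first, so that labels can be compared with
    distances modulo 4. *)
Definition residue (e : nat) : bool * bool := (odd e./2, odd e).

Lemma residue_eq2 e : (e == 2 %[mod 4])%N = (residue e == (true, false)).
Proof. by rewrite /residue xpair_eqE eqb_id eqbF_neg; lia. Qed.

(** * Closed walks of a finite relation, and of the arcs [step] *)

Lemma card_walksS (T : finType) (e : rel T) (m : nat) (x y : T) :
  #|[set s : m.+1.-tuple T | path e x s & last x s == y]| =
  (\sum_(z | e x z) #|[set s : m.-tuple T | path e z s & last z s == y]|)%N.
Proof.
rewrite -sum1_card.
rewrite (partition_big (fun s : m.+1.-tuple T => thead s) (e x)) /=; last first.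
  by move=> s; case/tupleP: s => z s; rewrite inE /= theadE; case/andP => /andP[-> _].
apply: eq_bigr => z exz; rewrite -sum1_card.
rewrite (reindex_onto (fun s : m.-tuple T => cons_tuple z s) (fun s => behead_tuple s)) /=.
  apply: eq_bigl => s; rewrite !inE /= theadE eqxx andbT exz /=.
  have -> : behead_tuple (cons_tuple z s) = s by apply/val_inj.
  by rewrite eqxx andbT.
move=> s; case/tupleP: s => w s /andP[_]; rewrite theadE => /eqP ->.
by apply/val_inj.
Qed.

(** A cyclic labelling [f] is read as the walk that starts at [f (-1)] and visits [f 0], [f 1], and
    so on; its last vertex is again [f (-1)]. *)
Lemma card_closed_walks (T : finType) (e : rel T) (m : nat) :
  #|[set f : {ffun 'I_m.+2 -> T} | [forall i, e (f i) (f (i + 1))]]| =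
  (\sum_x #|[set s : m.+2.-tuple T | path e x s & last x s == x]|)%N.
Proof.
pose g (f : {ffun 'I_m.+2 -> T}) := [tuple f i | i < m.+2].
have g_inj : injective g.
  by move=> f f' eqg; apply/ffunP => i; rewrite -[f i](tnth_mktuple f) -/(g f) eqg tnth_mktuple.
have nthg x0 f (i : 'I_m.+2) : nth x0 (g f) i = f i by rewrite -tnth_nth tnth_mktuple.
have lastg x f : last x (g f) = f (-1).
  rewrite (last_nth (f 0)) size_tuple /= -[RHS](nthg (f 0)); congr nth.
  by rewrite /= !modn_small.
(* Putting [f (-1)] in front shifts the list by one; the entry at 0 is where the cycle wraps
   around. *)
have nth_pred (f : {ffun _ -> T}) (i : 'I_m.+2) : nth (f 0) (f (-1) :: g f) i = f (i - 1).
  case: (unliftP 0 i) => [j|] -> /=; last by rewrite sub0r.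
  have -> : lift 0 j - 1 = widen_ord (leqnSn _) j.
    apply: (addIr 1); rewrite subrK; apply: val_inj => /=.
    by rewrite /bump /= (modn_small (isT : 1 < m.+2)%N) addn1 modn_small // ltnS ltn_ord.
  by rewrite -[X in nth _ _ X]/(val (widen_ord (leqnSn _) j)) nthg.
have pathg (f : {ffun 'I_m.+2 -> T}) :
    path e (f (-1)) (g f) = [forall i, e (f i) (f (i + 1))].
  apply/(pathP (f 0))/forallP => [eg i | ef i].
    by have := eg (i + 1); rewrite size_tuple ltn_ord nthg nth_pred addrK => /(_ isT).
  rewrite size_tuple => lt_i; have := ef (Ordinal lt_i - 1).
  by rewrite subrK -nth_pred -(nthg (f 0) f (Ordinal lt_i)).
rewrite -sum1_card (partition_big (fun f : {ffun _} => f (-1)) xpredT) //=.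
apply: eq_bigr => x _; rewrite sum1_card -(card_imset _ g_inj).
apply: eq_card => s; rewrite inE; apply/imsetP/andP => [[f]|[ps /eqP ls]].
  by rewrite unfold_in inE => /andP[ef /eqP <-] ->; rewrite pathg lastg eqxx.
have sg : s = g [ffun i => tnth s i].
  by apply: eq_from_tnth => i; rewrite tnth_mktuple ffunE.
exists [ffun i => tnth s i]; last exact: sg.
have fx : [ffun i => tnth s i] (-1) = x by rewrite -(lastg x) -sg ls.
by rewrite unfold_in inE -pathg fx -sg ps /=.
Qed.

(* In binary, the arcs 0 -> 1 -> 2 -> 3 -> 0 and 2 -> 0. *)
Definition step (p q : bool * bool) : bool :=
  if p.2 then q == (~~ p.1, false) else
  if p.1 then q.1 == q.2 else q == (false, true).

Lemma sum_bool2 (F : bool * bool -> nat) (P : pred (bool * bool)) :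
  (\sum_(z | P z) F z = P (true, true) * F (true, true) + P (true, false) * F (true, false)
    + (P (false, true) * F (false, true) + P (false, false) * F (false, false)))%N.
Proof.
rewrite big_mkcond /= (eq_bigr (fun z => if P (z.1, z.2) then F (z.1, z.2) else 0%N)).
  2: by case.
rewrite -(pair_bigA _ (fun x y => if P (x, y) then F (x, y) else 0%N)) /=.
by rewrite !big_bool /=; do 4 case: (P _); rewrite ?mul1n ?mul0n.
Qed.

Definition walks (m : nat) (x y : bool * bool) : nat :=
  #|[set s : m.-tuple (bool * bool) | path step x s & last x s == y]|.

Lemma walks0 x y : walks 0 x y = (x == y).
Proof.
rewrite /walks; have [<-|neq] := eqVneq x y.
  by apply: (@eq_card1 _ [tuple]) => s; rewrite !inE tuple0 /= !eqxx.
by apply: eq_card0 => s; rewrite !inE tuple0 /= (negPf neq).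
Qed.

Lemma walksS m y : (walks m.+1 (false, false) y = walks m (false, true) y)
  * (walks m.+1 (false, true) y = walks m (true, false) y)
  * (walks m.+1 (true, false) y = walks m (true, true) y + walks m (false, false) y)%N
  * (walks m.+1 (true, true) y = walks m (false, false) y).
Proof. by do !split; rewrite /walks card_walksS sum_bool2 /= ?mul1n ?mul0n ?addn0 ?add0n. Qed.

Definition closed_walks (m : nat) : nat := (\sum_x walks m x x)%N.

(** Unfolding first steps turns both sides into the same combination of terms [walks m]: this is
    [A ^+ 4 = A + 1], row by row. *)
Lemma closed_walks_rec m : closed_walks m.+4 = (closed_walks m + closed_walks m.+1)%N.
Proof. rewrite /closed_walks !sum_bool2 /= !mul1n !walksS; lia. Qed.

(** Initial values start at 1, because [closed_walks 0] is 4 whereas [tilings 0 0] is 0. *)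
Lemma closed_walks_small :
  (closed_walks 1 = 0) * (closed_walks 2 = 0) * (closed_walks 3 = 3)
    * (closed_walks 4 = 4).
Proof.
by do !split; rewrite /closed_walks sum_bool2 /= !mul1n !walksS !walks0.
Qed.

(** * Cyclic tilings by pieces of length 3 and 4 *)

(* The number of ways to cut a cycle of length [3 * l + 4 * b] into [l] pieces
   of length 3 and [b] pieces of length 4; [tilings 0 0 = 0] as [x / 0 = 0]. *)
Definition tilings (l b : nat) : rat :=
  (3 * l + 4 * b)%:R / (l + b)%:R * 'C(l + b, l)%:R.

Lemma tilings0 b : tilings 0 b.+1 = 4.
Proof. by rewrite /tilings muln0 !add0n bin0 mulr1 natrM mulfK ?pnatr_eq0. Qed.

Lemma tilingsn0 l : tilings l.+1 0 = 3.
Proof. by rewrite /tilings muln0 !addn0 binn mulr1 natrM mulfK ?pnatr_eq0. Qed.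

(** Pascal's rule, as [tilings l b] is [3 'C(l + b - 1, l - 1) + 4 'C(l + b - 1, l)] for positive
    [l] and [b]. The proof writes both binomials on the right as multiples of ['C(m.+2, l.+1)] and
    compares the coefficients. *)
Lemma tilingsSS l b : tilings l.+1 b.+1 = tilings l b.+1 + tilings l.+1 b.
Proof.
rewrite /tilings (addSn l b.+1) (addSn l b) (addnS l b); set m := (l + b)%N.
have Cl : 'C(m.+1, l)%:R = l.+1%:R / m.+2%:R * 'C(m.+2, l.+1)%:R :> rat.
  have /(congr1 (fun k => k%:R : rat)) := mul_bin_diag m.+2 l.
  by rewrite !natrM => h; rewrite mulrAC -h mulrC mulKf // pnatr_eq0.
have Cb : 'C(m.+1, l.+1)%:R = b.+1%:R / m.+2%:R * 'C(m.+2, l.+1)%:R :> rat.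
  have /(congr1 (fun k => k%:R : rat)) := mul_bin_down m.+2 l.+1.
  have -> : (m.+2 - l.+1 = b.+1)%N by rewrite /m; lia.
  by rewrite !natrM => h; rewrite mulrAC -h mulrC mulKf // pnatr_eq0.
rewrite Cl Cb /m; field.
by have := ler0n rat l; have := ler0n rat b; move=> b0 l0; apply/andP; split; apply: lt0r_neq0; lra.
Qed.

(** The bound [K] is separate from [n] so that the recurrence compares sums over one range. *)
Definition tiling_sum (K n : nat) : rat :=
  \sum_(l < K) \sum_(b < K | (3 * l + 4 * b == n)%N) tilings l b.

Lemma tiling_sum_rec K n :
  (0 < n)%N -> (n.+1 < K)%N -> tiling_sum K n.+4 = tiling_sum K n + tiling_sum K n.+1.
Proof.
case: K => // K n_gt0 ltnK.
(* The tilings left after removing a piece of length 3 ([shl]) or 4 ([shb]), or 0 if there is no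
   such piece. Since [0 < n], a single piece of length 4 does not occur; removing it would leave
   [tilings 0 0 = 0] in place of 4. *)
pose shl l b := if l is l'.+1 then tilings l' b else 0.
pose shb l b := if b is b'.+1 then tilings l b' else 0.
have tilingsE l b : (3 * l + 4 * b == n.+4)%N -> tilings l b = shb l b + shl l b.
  case: l b => [|l] [|b] eqn /=; last by rewrite tilingsSS addrC.
  - by rewrite /tilings invr0 mulr0 mul0r addr0.
  - by case: b eqn => [|b] eqn; [exfalso; lia | rewrite !tilings0 addr0].
  - by case: l eqn => [|l] eqn; [exfalso; lia | rewrite !tilingsn0 add0r].
rewrite /tiling_sum (eq_bigr (fun l : 'I_K.+1 =>
  \sum_(b < K.+1 | (3 * l + 4 * b == n.+4)%N) shb l b +
  \sum_(b < K.+1 | (3 * l + 4 * b == n.+4)%N) shl l b)); last first.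
  by move=> l _; rewrite -big_split; apply: eq_bigr => b; apply: tilingsE.
rewrite big_split /=; congr (_ + _).
  apply: eq_bigr => l _; rewrite !(big_mkcond (fun b : 'I_ _ => _ == _)) /=.
  (* The term [b = 0] on the left vanishes by [shb], the last one on the right because [4 * K]
     exceeds [n]; the others match after a shift by one. *)
  rewrite big_ord_recl [in RHS]big_ord_recr /= if_same add0r.
  rewrite [X in _ = _ + X]ifF ?addr0; last by lia.
  apply: eq_bigr => b _; rewrite /bump /= add1n; congr (if _ then _ else _); lia.
rewrite big_ord_recl [in RHS]big_ord_recr /= big1 // add0r.
rewrite [X in _ = _ + X]big_pred0 ?addr0; last by move=> b; lia.
by apply: eq_bigr => l _; apply: eq_bigl => b; rewrite /bump /=; lia.
Qed.

(** Same recurrence and same initial values: 1 and 2 are not of the form [3 * l + 4 * b], while 3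
    and 4 are in exactly one way. *)
Lemma tiling_sum_closed_walks K n :
  (0 < n < K)%N -> tiling_sum K n = (closed_walks n)%:R.
Proof.
have tiling_sum1 (k l0 b0 : nat) (ltl : (l0 < K)%N) (ltb : (b0 < K)%N) :
    (forall l b, (3 * l + 4 * b == k)%N = (l == l0) && (b == b0)) ->
    tiling_sum K k = tilings l0 b0.
  move=> kE; rewrite /tiling_sum (bigD1 (Ordinal ltl)) //= [X in _ + X]big1 ?addr0 => [|l neq].
    by rewrite (big_pred1 (Ordinal ltb)) // => b; rewrite kE eqxx.
  by rewrite big_pred0 // => b; rewrite kE (_ : (_ == l0) = false) //; apply/negbTE.
elim/ltn_ind: n => -[|[|[|[|[|n]]]]] IH //= ltK.
- by rewrite closed_walks_small /tiling_sum big1 // => l _; apply: big_pred0 => b; lia.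
- by rewrite closed_walks_small /tiling_sum big1 // => l _; apply: big_pred0 => b; lia.
- by rewrite closed_walks_small (@tiling_sum1 _ 1 0) ?tilingsn0 //; lia.
- by rewrite closed_walks_small (@tiling_sum1 _ 0 1) ?tilings0 //; lia.
- by rewrite tiling_sum_rec ?closed_walks_rec ?natrD ?IH //; lia.
Qed.

(** Given [l], the only possible [b] is [(n - 3 * l) %/ 4]; the bound on [l] makes the truncated
    subtraction exact. *)
Lemma tiling_sumE n : (0 < n)%N ->
  \sum_(0 <= l < (n %/ 3).+1 | (n - 3 * l == 0 %[mod 4])%N)
    n%:R / (l + (n - 3 * l) %/ 4)%:R * 'C(l + (n - 3 * l) %/ 4, l)%:R
  = tiling_sum n.+1 n.
Proof.
move=> n_gt0; rewrite (big_nat_widen _ _ n.+1); last by lia.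
rewrite big_mkord big_mkcond; apply: eq_bigr => l _.
case: ifP => [/andP[mod4 le_l]|ncond]; last first.
  by rewrite big_pred0 // => b; apply/negP => /eqP eqn; move/negP: ncond; apply; lia.
have ltb : ((n - 3 * l) %/ 4 < n.+1)%N by lia.
rewrite (big_pred1 (Ordinal ltb)) => [|b]; last first.
  by rewrite /= -val_eqE /=; lia.
rewrite /tilings /=; congr (_%:R / _ * _); lia.
Qed.

(** * Perfect matchings through vertex degrees *)

Lemma perfect_matchingE (V : finType) (E M : {set {set V}}) :
  perfect_matching E M =
  (M \subset E) && [forall x, #|[set A in M | x \in A]| == 1%N].
Proof.
rewrite /perfect_matching; congr (_ && _).
apply/andP/forallP => [[/trivIsetP triv /eqP cov] x | deg].
  have /bigcupP[A AM xA] : x \in cover M by rewrite cov inE.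
  apply/cards1P; exists A; apply/setP => B; rewrite !inE.
  apply/andP/eqP => [[BM xB]|->] //.
  apply/eqP; apply: contraTT (xB) => neq.
  by have /disjointFl -> := triv _ _ BM AM neq.
split.
  apply/trivIsetP => A B AM BM; apply: contraNT => /pred0Pn[x /andP[/= xA xB]].
  have /cards1P[C eqC] := deg x.
  have : A \in [set A in M | x \in A] by rewrite inE AM.
  have : B \in [set A in M | x \in A] by rewrite inE BM.
  by rewrite eqC !inE => /eqP -> /eqP ->.
apply/eqP/setP => x; rewrite inE.
have /cards1P[C eqC] := deg x; have : C \in [set A in M | x \in A] by rewrite eqC inE.
by rewrite inE => /andP[CM xC]; apply/bigcupP; exists C.
Qed.

Lemma natr_Zp_eq0 (n k : nat) : (1 < n)%N -> ((k%:R : 'Z_n) == 0) = (n %| k)%N.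
Proof. by move=> n_gt1; rewrite -val_eqE /= val_Zp_nat. Qed.

Section Edges.
Variable n : nat.
Implicit Types (i j : 'Z_n) (M : {set {set vertex n}}).

Lemma u_uu i j : (u i \in uu j) = (i == j) || (i == j + 2).
Proof. by rewrite !inE. Qed.

Lemma u_spoke i j : (u i \in spoke j) = (i == j).
Proof. by rewrite !inE orbF. Qed.

Lemma u_vv i j : (u i \in vv j) = false.
Proof. by rewrite !inE. Qed.

Lemma v_vv i j : (v i \in vv j) = (i == j) || (i == j + 1).
Proof. by rewrite !inE. Qed.

Lemma v_spoke i j : (v i \in spoke j) = (i == j).
Proof. by rewrite !inE. Qed.

Lemma v_uu i j : (v i \in uu j) = false.
Proof. by rewrite !inE. Qed.

Lemma uu_spoke i j : (uu i == spoke j) = false.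
Proof. by apply/eqP => /setP/(_ (v j)); rewrite v_uu v_spoke eqxx. Qed.

Lemma uu_vv i j : (uu i == vv j) = false.
Proof. by apply/eqP => /setP/(_ (v j)); rewrite v_uu v_vv eqxx. Qed.

Lemma vv_spoke i j : (vv i == spoke j) = false.
Proof. by apply/eqP => /setP/(_ (u j)); rewrite u_vv u_spoke eqxx. Qed.

Lemma spoke_inj : injective (@spoke n).
Proof. by move=> i j /setP/(_ (u i)); rewrite !u_spoke eqxx => /esym/eqP. Qed.

Lemma vv_inj : (2 < n)%N -> injective (@vv n).
Proof.
move=> n_gt2 i j eqij; have /setP/(_ (v i)) := eqij; have /setP/(_ (v j)) := eqij.
rewrite !v_vv !eqxx => /orP[/eqP //|/eqP ji] /esym/orP[/eqP //|/eqP ij].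
have : (2%:R : 'Z_n) == 0 by apply/eqP/(addrI i); rewrite addr0 [RHS]ij ji -addrA.
by rewrite natr_Zp_eq0 ?(ltnW n_gt2) // => /dvdn_leq; lia.
Qed.

(** A coincidence between distinct indices gives 4 = 0 modulo [n]. For [n = 4], [uu i] and
    [uu (i + 2)] really are the same edge, hence the separate treatment of that case. *)
Lemma uu_inj : (2 < n)%N -> n != 4%N -> injective (@uu n).
Proof.
move=> n_gt2 n_neq4 i j eqij; have /setP/(_ (u i)) := eqij; have /setP/(_ (u j)) := eqij.
rewrite !u_uu !eqxx => /orP[/eqP //|/eqP ji] /esym/orP[/eqP //|/eqP ij].
have : (4%:R : 'Z_n) == 0 by apply/eqP/(addrI i); rewrite addr0 [RHS]ij ji -addrA -natrD.
rewrite natr_Zp_eq0 ?(ltnW n_gt2) // => n4; have n_le4 := dvdn_leq (isT : (0 < 4)%N) n4.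
by suff n3 : (n %| 4)%N = false; [rewrite n3 in n4 | have -> : n = 3 by lia].
Qed.

Lemma petersen2P A : reflect
  ((exists i, A = uu i) \/ (exists i, A = spoke i) \/ (exists i, A = vv i))
  (A \in petersen2 n).
Proof.
rewrite !inE; apply: (iffP idP).
  case/orP => [/orP[]|] /imsetP[i _ ->]; [left|right; left|right; right]; by exists i.
by case=> [[i ->]|[[i ->]|[i ->]]]; rewrite imset_f ?orbT.
Qed.

Lemma card_inset3 (T : finType) (P : {set T}) (a b c : T) :
  a != b -> a != c -> b != c ->
  #|P :&: (a |: (b |: [set c]))| = ((a \in P) + (b \in P) + (c \in P))%N.
Proof.
move=> ab ac bc; rewrite -sum1_card (eq_bigl (fun x => (x \in a |: (b |: [set c])) && (x \in P))).
  rewrite big_mkcondr big_setU1 ?inE ?negb_or ?ab //= big_setU1 ?inE //= big_set1.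
  by rewrite addnA; do 3 case: (_ \in P).
by move=> x; rewrite inE andbC.
Qed.

Lemma u_degree M i : (2 < n)%N -> n != 4%N -> M \subset petersen2 n ->
  #|[set A in M | u i \in A]| =
  ((uu i \in M) + (uu (i - 2)%R \in M) + (spoke i \in M))%N.
Proof.
move=> n_gt2 n_neq4 /subsetP ME.
have inj := inj_eq (uu_inj n_gt2 n_neq4).
rewrite -card_inset3 ?inj ?uu_spoke //; last first.
  by rewrite -subr_eq0 opprB addrC subrK natr_Zp_eq0 ?(ltnW n_gt2) //; apply/negP => /dvdn_leq; lia.
apply: eq_card => A; rewrite !inE; case AM: (A \in M) => //=.
have /petersen2P[[j ->]|[[j ->]|[j ->]]] := ME _ AM.
- by rewrite u_uu !inj uu_spoke orbF ![j == _]eq_sym subr_eq.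
- by rewrite u_spoke ![spoke j == _]eq_sym !uu_spoke /= (inj_eq spoke_inj).
- by rewrite u_vv ![vv j == _]eq_sym !uu_vv /= eq_sym vv_spoke.
Qed.

Lemma v_degree M i : (2 < n)%N -> M \subset petersen2 n ->
  #|[set A in M | v i \in A]| =
  ((vv i \in M) + (vv (i - 1)%R \in M) + (spoke i \in M))%N.
Proof.
move=> n_gt2 /subsetP ME.
have inj := inj_eq (vv_inj n_gt2).
rewrite -card_inset3 ?inj ?vv_spoke //; last first.
  by rewrite -subr_eq0 opprB addrC subrK oner_eq0.
apply: eq_card => A; rewrite !inE; case AM: (A \in M) => //=.
have /petersen2P[[j ->]|[[j ->]|[j ->]]] := ME _ AM.
- by rewrite v_uu !uu_vv uu_spoke.
- by rewrite v_spoke ![spoke j == _]eq_sym !vv_spoke /= (inj_eq spoke_inj).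
- by rewrite v_vv !inj vv_spoke orbF ![j == _]eq_sym subr_eq.
Qed.

Lemma perfect_matching_degree M : (2 < n)%N -> n != 4%N ->
  reflect [/\ M \subset petersen2 n,
     forall i, ((uu i \in M) + (uu (i - 2)%R \in M) + (spoke i \in M) = 1)%N &
     forall i, ((vv i \in M) + (vv (i - 1)%R \in M) + (spoke i \in M) = 1)%N]
    (perfect_matching (petersen2 n) M).
Proof.
move=> n_gt2 n_neq4; rewrite perfect_matchingE.
apply: (iffP andP) => [[ME /forallP deg]|[ME du dv]]; split=> //.
- by move=> i; rewrite -u_degree //; apply/eqP.
- by move=> i; rewrite -v_degree //; apply/eqP.
by apply/forallP => -[] i; rewrite -/(u i) -/(v i) ?u_degree ?v_degree ?du ?dv.
Qed.
End Edges.

(** * Labels in the gaps between spokes *)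

Lemma residueS e : residue e.+1 = (odd e (+) odd e./2, ~~ odd e).
Proof. by rewrite /residue /= uphalf_half oddD oddb. Qed.

Lemma step_residue e : step (residue e) (residue e.+1).
Proof. by rewrite residueS /step /residue; case: (odd e); case: (odd e./2). Qed.

Section Gaps.
Variable n : nat.
Implicit Types (i j x y : 'Z_n) (p s : pred 'Z_n).

Lemma Zp_natr_lt x : (1 < n)%N -> exists2 k : nat, (k < n)%N & x = k%:R.
Proof.
move=> n_gt1; exists (x : nat); last by rewrite natr_Zp.
by rewrite -[X in (_ < X)%N](Zp_cast n_gt1).
Qed.

(** Offsets start at 0, so [x] itself may be the answer; going round the cycle meets [y] in fewer
    than [n] steps. *)
Lemma first_after s x y : (1 < n)%N -> s y ->
  exists2 k, (k < n)%N & s (x + k%:R) /\ forall e, (e < k)%N -> ~~ s (x + e%:R).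
Proof.
move=> n_gt1 sy; have [k0 ltk0 yx] := Zp_natr_lt (y - x) n_gt1.
have ex_k : exists k, s (x + k%:R) by exists k0; rewrite -yx addrC subrK.
case: (ex_minnP ex_k) => k sk min; exists k.
  by apply: leq_ltn_trans ltk0; apply: min; rewrite -yx addrC subrK.
by split=> // e; rewrite ltnNge; apply: contra; apply: min.
Qed.

Lemma last_before s x y : (1 < n)%N -> s y ->
  exists2 k, (k < n)%N & s (x - k%:R) /\ forall e, (e < k)%N -> ~~ s (x - e%:R).
Proof.
move=> n_gt1 sy; pose s' i := s (x - i).
have s'y : s' (x - y) by rewrite /s' opprB addrC subrK.
have [k ltk [sk nsk]] := first_after 0 n_gt1 s'y.
rewrite /s' add0r in sk.
by exists k => //; split=> // e /nsk; rewrite add0r.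
Qed.

(** Where there is no spoke, the degree equation flips [p] at each step of length [d]. Used with
    [d = 2] for the edges [uu] and [d = 1] for [vv]. *)
Lemma alternating p s (d : nat) i k :
  (forall i, (p i + p (i - d%:R)%R + s i = 1)%N) ->
  (forall e, (e < k)%N -> ~~ s (i + (d * e.+1)%:R)) ->
  p (i + (d * k)%:R) = odd k (+) p i.
Proof.
move=> deg; elim: k => [|k IH] ns; first by rewrite muln0 addr0.
have := deg (i + (d * k.+1)%:R); rewrite (negPf (ns k _)) // addn0.
rewrite {2}mulnSr natrD addrA addrK IH => [|e lte]; last exact/ns/ltnW.
by rewrite /=; do 2 case: (p _); case: (odd k).
Qed.

(** These record whether [uu i], [vv i] and [spoke i] lie in a matching; in [gaps], a sole spoke is
    the case [k = n - 1]. *)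
Variables a b s : pred 'Z_n.
Hypothesis n_gt1 : (1 < n)%N.
Hypothesis deg_a : forall i, (a i + a (i - 2)%R + s i = 1)%N.
Hypothesis deg_b : forall i, (b i + b (i - 1)%R + s i = 1)%N.
Hypothesis gaps : forall i k, (k < n)%N -> s i -> s (i + k.+1%:R) ->
  (forall e, (e < k)%N -> ~~ s (i + e.+1%:R)) -> residue k = (true, false).

Lemma spoke_free i : s i -> (a i = false) * (b i = false).
Proof. by move=> si; split; [move: (deg_a i) | move: (deg_b i)]; rewrite si; lia. Qed.

(* The parity classes of the outer vertices of two adjacent gaps are joined
   across the spoke separating them, so only the gap before [j] decides [a (j - 1)]. *)
Lemma uu_across j : s j -> a (j - 1).
Proof.
move=> sj; have [k ltk [sk nsk]] := last_before (j - 1) n_gt1 sj.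
pose i := j - 1 - k%:R.
have ij e : (e <= k)%N -> i + e%:R = j - 1 - (k - e)%:R.
  by move=> le_ek; rewrite natrB // /i; ring.
have ns e : (e < k)%N -> ~~ s (i + e.+1%:R) by move=> ltek; rewrite ij //; apply: nsk; lia.
have ijk : i + k%:R = j - 1 by rewrite ij // subnn subr0.
have ijk1 : i + k.+1%:R = j by rewrite -natr1 addrA ijk subrK.
have := gaps ltk sk _ ns; rewrite ijk1 => /(_ sj) [odd_half odd_k].
have kE : k = (2 * k./2)%N by rewrite mul2n even_halfK ?odd_k.
(* As [k] is 2 modulo 4, an odd number [k./2] of flips leads from [a i = false] to [a (j - 1)]. *)
rewrite -ijk kE (alternating deg_a) => [|e lte]; first by rewrite odd_half (spoke_free sk).
by rewrite mulnS; apply: ns; lia.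
Qed.

(** [b] alternates from [b i = false]. The two parity classes of [a] start separately: even offsets
    from [a i = false], odd ones from [a (i + 1)], which is false because [uu_across] gives
    [a (i - 1)]. *)
Lemma residue_in_gap i k e : s i -> (e <= k)%N ->
  (forall d, (d < k)%N -> ~~ s (i + d.+1%:R)) ->
  (a (i + e%:R), b (i + e%:R)) = residue e.
Proof.
move=> si le_ek ns; rewrite /residue; congr (_, _); last first.
  rewrite -[e in LHS]mul1n (alternating (d := 1) deg_b) ?(spoke_free si) ?addbF // => d lt_de.
  by rewrite mul1n; apply: ns; lia.
rewrite -{1}(odd_double_half e) -mul2n natrD addrA; case: (boolP (odd e)) => odd_e.
  rewrite (alternating deg_a) => [|d lt_d].
    have := deg_a (i + 1); rewrite -[_ - _]addrA.
    have -> : i + (1 - 2) = i - 1 by ring.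
    rewrite uu_across // (negPf (ns 0%N _)) ?addn0; last by lia.
    by case: (a _); rewrite ?addbF.
  by rewrite -addrA -natrD; apply: ns; lia.
rewrite addr0 (alternating deg_a) ?(spoke_free si) ?addbF // => d lt_d.
by rewrite mulnS; apply: ns; lia.
Qed.

(** Let [i] be the last spoke up to [x] and [i + k.+1] the next one. Inside the gap the residue
    grows by 1; at its end, [gaps] yields the arc [2 -> 0]. *)
Lemma step_of_gaps y x : s y -> step (a x, b x) (a (x + 1), b (x + 1)).
Proof.
move=> sy; have [e lte [se nse]] := last_before x n_gt1 sy.
pose i := x - e%:R.
have [k ltk [sk nsk]] := first_after (i + 1) n_gt1 sy.
have succ d : i + 1 + d%:R = i + d.+1%:R by rewrite -addrA nat1r.
have {}nsk d : (d < k)%N -> ~~ s (i + d.+1%:R) by move=> /nsk; rewrite succ.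
rewrite succ in sk.
have le_ek : (e <= k)%N.
  (* Otherwise the spoke at [i + k.+1] would lie after [i] and no later than [x]. *)
  rewrite leqNgt; apply/negP => lt_ke; have /negP := nse (e - k.+1)%N ltac:(lia).
  by rewrite natrB // opprB addrA addrAC sk.
have xE : x = i + e%:R by rewrite subrK.
rewrite {1 2}xE (residue_in_gap se le_ek nsk).
have x1E : x + 1 = i + e.+1%:R by rewrite xE -addrA natr1.
rewrite x1E; case: (ltngtP e k) le_ek => // [lt_ek|ek] _.
  by rewrite (residue_in_gap se lt_ek nsk) step_residue.
by rewrite ek !(spoke_free sk) (gaps ltk se sk nsk).
Qed.
End Gaps.

(** * Correspondence between labellings and matchings *)

Lemma eq_residue e e' : (residue e == residue e') = (e == e' %[mod 4])%N.
Proof. by rewrite /residue xpair_eqE; lia. Qed.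

Lemma residue_surj p : exists2 c, (c < 4)%N & p = residue c.
Proof. by case: p => -[] []; [exists 3%N | exists 2%N | exists 1%N | exists 0%N]. Qed.

(** [2 -> 0] is the only arc that does not add 1 modulo 4. *)
Lemma step_residueP e q : step (residue e) q ->
  ~~ ((residue e == (true, false)) && (q == (false, false))) -> q = residue e.+1.
Proof.
rewrite residueS /step /residue.
by case: q => -[] []; case: (odd e); case: (odd e./2).
Qed.

Section Labels.
Variable n : nat.
Hypotheses (n_gt2 : (2 < n)%N) (n_neq4 : n != 4%N).
Let n_gt1 : (1 < n)%N := ltnW n_gt2.
Implicit Types (i x : 'Z_n) (A : {set vertex n}) (M : {set {set vertex n}})
  (f : {ffun 'Z_n -> bool * bool}).

Definition labels M : {ffun 'Z_n -> bool * bool} := [ffun i => (uu i \in M, vv i \in M)].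

Definition label_spoke f i := (f (i - 1) == (true, false)) && (f i == (false, false)).

Definition matching_of f : {set {set vertex n}} :=
  (@uu n @: [set i | (f i).1]) :|: (@vv n @: [set i | (f i).2])
    :|: (@spoke n @: [set i | label_spoke f i]).

Definition valid f := [forall i, step (f i) (f (i + 1))].

Lemma matching_of_uu f i : (uu i \in matching_of f) = (f i).1.
Proof.
rewrite !in_setU mem_imset ?inE; last exact: uu_inj.
apply/orP/idP => [[/orP[//|/imsetP[j _ /eqP]]|/imsetP[j _ /eqP]]|->]; last by left.
  by rewrite uu_vv.
by rewrite uu_spoke.
Qed.

Lemma matching_of_vv f i : (vv i \in matching_of f) = (f i).2.
Proof.
rewrite !in_setU [X in _ || X || _]mem_imset ?inE; last exact: vv_inj.
apply/orP/idP => [[/orP[/imsetP[j _ /eqP]|//]|/imsetP[j _ /eqP]]|->].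
- by rewrite eq_sym uu_vv.
- by rewrite vv_spoke.
- by left; rewrite orbT.
Qed.

Lemma matching_of_spoke f i : (spoke i \in matching_of f) = label_spoke f i.
Proof.
rewrite !in_setU [X in _ || X]mem_imset ?inE; last exact: spoke_inj.
apply/orP/idP => [[/orP[]/imsetP[j _ /eqP]|//]|->]; last by right.
  by rewrite eq_sym uu_spoke.
by rewrite eq_sym vv_spoke.
Qed.

Lemma matching_ofK : cancel matching_of labels.
Proof.
by move=> f; apply/ffunP => i; rewrite ffunE matching_of_uu matching_of_vv; case: (f i).
Qed.

Lemma matching_of_sub f : matching_of f \subset petersen2 n.
Proof.
apply/subsetP => A; rewrite !in_setU => /orP[/orP[]|] /imsetP[i _ ->];
by rewrite imset_f ?orbT.
Qed.

(** The equation at [u i] involves only the labels at [i - 2], [i - 1] and [i], the one at [v i]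
    only the last two: a finite check over successive arcs. *)
Lemma perfect_matching_of f : valid f -> perfect_matching (petersen2 n) (matching_of f).
Proof.
move=> /forallP fv; apply/perfect_matching_degree => //; split; first exact: matching_of_sub.
  move=> i; rewrite !matching_of_uu matching_of_spoke /label_spoke.
  have := fv (i - 1); rewrite subrK; have := fv (i - 2).
  have -> : i - 2 + 1 = i - 1 by ring.
  by case: (f (i - 2)) => -[] []; case: (f (i - 1)) => -[] []; case: (f i) => -[] [].
move=> i; rewrite !matching_of_vv matching_of_spoke /label_spoke.
have := fv (i - 1); rewrite subrK.
by case: (f (i - 1)) => -[] []; case: (f i) => -[] [].
Qed.

Lemma residue_run f i k c : valid f -> f i = residue c ->
  (forall e, (e < k)%N -> ~~ label_spoke f (i + e.+1%:R)) ->
  forall e, (e <= k)%N -> f (i + e%:R) = residue (c + e).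
Proof.
move=> /forallP fv fi ns; elim=> [|e IH] le_ek; first by rewrite addr0 addn0.
have := fv (i + e%:R); rewrite -addrA natr1 IH ?(ltnW le_ek) // addnS.
move=> /step_residueP; apply; have := ns e le_ek.
by rewrite /label_spoke -natr1 addrA addrK IH ?(ltnW le_ek).
Qed.

Lemma mem_spokeless_matching i A : reflect
  (exists2 q, (q < n %/ 4)%N & [\/ A = uu (i + (4 * q)%:R), A = uu (i + (4 * q + 1)%:R),
     A = vv (i + (4 * q + 1)%:R) | A = vv (i + (4 * q + 3)%:R)])
  (A \in spokeless_matching i).
Proof.
have -> : spokeless_matching i = \bigcup_(k < n %/ 4)
    [set uu (i + (4 * k)%:R); uu (i + (4 * k + 1)%:R);
         vv (i + (4 * k + 1)%:R); vv (i + (4 * k + 3)%:R)].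
  by apply: eq_bigr => k _; rewrite /uu /vv -!addrA -!natrD !natr1 !addnS !addn0.
apply: (iffP bigcupP) => [[q _]|[q ltq Aq]].
  rewrite !inE => Aq; exists q => //.
  by move: Aq; rewrite -!orbA => /or4P[] /eqP ->; constructor.
by exists (Ordinal ltq) => //; rewrite !inE; case: Aq => ->; rewrite eqxx ?orbT.
Qed.

(** The label is 0 at a spoke and 2 just before the next one; the [k] arcs between add 1 each, so
    [k] is 2 modulo 4. *)
Lemma spoke_type_matching_of f i : valid f -> label_spoke f i -> spoke_type (matching_of f).
Proof.
move=> fv si; apply/andP; split.
  by apply/existsP; exists i; rewrite matching_of_spoke.
apply/forallP => j; apply/forallP => k; apply/implyP => /and3P[].
rewrite !matching_of_spoke => /andP[_ /eqP fj] /andP[/eqP fjk _] /forallP ns.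
rewrite -natr1 addrA addrK in fjk.
rewrite residue_eq2 -(add0n k) -(@residue_run f j k 0 fv fj _ k (leqnn k)) ?fjk // => e lte.
by have := ns (Ordinal lte); rewrite matching_of_spoke.
Qed.

Lemma spokeless_type_matching_of f : valid f -> (forall i, ~~ label_spoke f i) ->
  spokeless_type (matching_of f).
Proof.
move=> fv ns; have [c ltc f0] := residue_surj (f 0).
have fE k : f k%:R = residue (c + k).
  by rewrite -[k%:R]add0r (@residue_run f 0 k c).
have n4 : (4 %| n)%N.
  have := fE n; rewrite (_ : n%:R = 0); last by apply/eqP; rewrite natr_Zp_eq0.
  by rewrite f0 => /eqP; rewrite eq_residue; lia.
apply/and3P; split=> //; first by apply/forallP => i; rewrite matching_of_spoke.
(* The base point of [spokeless_matching] carries the label 2. Since [c < 4], [6 - c] is an exact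
   subtraction, and 6 is 2 modulo 4. *)
pose i0 : 'Z_n := (6 - c)%:R.
have fi0 k : f (i0 + k%:R) = residue (k + 2).
  by rewrite -natrD fE; apply/eqP; rewrite eq_residue; lia.
apply/existsP; exists i0; rewrite eqEsubset; apply/andP; split; apply/subsetP => A.
  move=> AM; apply/mem_spokeless_matching; move: (AM).
  have /petersen2P[[x ->]|[[x ->]|[x ->]]] := subsetP (matching_of_sub f) _ AM.
  - have [k ltk xk] := Zp_natr_lt (x - i0) n_gt1.
    have {xk} -> : x = i0 + k%:R by rewrite -xk addrC subrK.
    rewrite matching_of_uu fi0 /residue /= => k2; exists (k %/ 4)%N; first by lia.
    have [r0|r1] : (k = 4 * (k %/ 4) \/ k = 4 * (k %/ 4) + 1)%N by lia.
      by constructor 1; rewrite -r0.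
    by constructor 2; rewrite -r1.
  - by rewrite matching_of_spoke (negPf (ns x)).
  - have [k ltk xk] := Zp_natr_lt (x - i0) n_gt1.
    have {xk} -> : x = i0 + k%:R by rewrite -xk addrC subrK.
    rewrite matching_of_vv fi0 /residue /= => k2; exists (k %/ 4)%N; first by lia.
    have [r1|r3] : (k = 4 * (k %/ 4) + 1 \/ k = 4 * (k %/ 4) + 3)%N by lia.
      by constructor 3; rewrite -r1.
    by constructor 4; rewrite -r3.
by move/mem_spokeless_matching => [q ltq [] ->];
  rewrite ?matching_of_uu ?matching_of_vv fi0 /residue /=; lia.
Qed.

(** Presence of an edge is read off the explicit set; absence follows from the degree equations,
    which avoids comparing indices modulo [n]. *)
Lemma labels_spokeless M i k : perfect_matching (petersen2 n) M -> (4 %| n)%N ->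
  M = spokeless_matching i -> labels M (i + k%:R) = residue (k + 2).
Proof.
move=> /(perfect_matching_degree _ n_gt2 n_neq4)[_ deg_u deg_v] n4 ME.
wlog ltk : k / (k < n)%N => [wlogk|].
  have := wlogk (k %% n)%N; rewrite ltn_mod (ltnW n_gt1) => /(_ isT).
  by rewrite Zp_nat_mod // => ->; apply/eqP; rewrite eq_residue; lia.
have [uu0M uu1M vv1M vv3M] : [/\ uu (i + (4 * (k %/ 4))%:R) \in M,
    uu (i + (4 * (k %/ 4) + 1)%:R) \in M, vv (i + (4 * (k %/ 4) + 1)%:R) \in M &
    vv (i + (4 * (k %/ 4) + 3)%:R) \in M].
  have ltq : (k %/ 4 < n %/ 4)%N by lia.
  by rewrite ME; split; apply/mem_spokeless_matching; exists (k %/ 4)%N => //;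
    [constructor 1|constructor 2|constructor 3|constructor 4].
have not_uu m : uu (i + m%:R) \in M -> (uu (i + (m + 2)%:R) \in M) = false.
  by move=> um; have := deg_u (i + (m + 2)%:R); rewrite natrD addrA addrK um; lia.
have not_vv m : vv (i + m%:R) \in M -> (vv (i + (m + 1)%:R) \in M) = false.
  by move=> vm; have := deg_v (i + (m + 1)%:R); rewrite natrD addrA addrK vm; lia.
have not_vv' m : vv (i + (m + 1)%:R) \in M -> (vv (i + m%:R) \in M) = false.
  rewrite natrD addrA => vm; have := deg_v (i + m%:R + 1%:R).
  by rewrite addrK vm; lia.
set q := (k %/ 4)%N in uu0M uu1M vv1M vv3M.
have vv2M : (vv (i + (4 * q + 2)%:R) \in M) = false by rewrite (addnA _ 1%N 1%N) not_vv.
have uu3M : (uu (i + (4 * q + 3)%:R) \in M) = false by rewrite (addnA _ 1%N 2%N) not_uu.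
rewrite ffunE; have [kE|[kE|[kE|kE]]] :
  (k = 4 * q \/ k = 4 * q + 1 \/ k = 4 * q + 2 \/ k = 4 * q + 3)%N by rewrite /q; lia.
- by rewrite kE uu0M not_vv' //; apply/esym/eqP; rewrite (eq_residue _ 2); lia.
- by rewrite kE uu1M vv1M; apply/esym/eqP; rewrite (eq_residue _ 3); lia.
- by rewrite kE not_uu // vv2M; apply/esym/eqP; rewrite (eq_residue _ 0); lia.
- by rewrite kE uu3M vv3M; apply/esym/eqP; rewrite (eq_residue _ 1); lia.
Qed.

Lemma M2P M : reflect (perfect_matching (petersen2 n) M /\
    (spoke_type M \/ spokeless_type M)) (M \in M2 n).
Proof. by rewrite inE (negPf n_neq4); apply: (iffP andP) => -[pm /orP]. Qed.

Lemma valid_labels M : M \in M2 n -> valid (labels M).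
Proof.
move=> /M2P[pm Mtype]; apply/forallP => x.
have /(perfect_matching_degree _ n_gt2 n_neq4)[_ deg_u deg_v] := pm.
case: Mtype => [/andP[/existsP[y sy] gaps]|/and3P[_ n4 /existsP[i /eqP ME]]].
  rewrite !ffunE; apply: (@step_of_gaps n (fun i => uu i \in M) (fun i => vv i \in M)
    (fun i => spoke i \in M) n_gt1 deg_u deg_v _ y x sy) => {sy}j k ltk sj sk ns.
  apply/eqP; rewrite -residue_eq2.
  have /forallP/(_ (Ordinal ltk))/implyP := forallP gaps j; apply.
  by apply/and3P; split=> //; apply/forallP => e; apply: ns.
have [k _ xk] := Zp_natr_lt (x - i) n_gt1.
have -> : x = i + k%:R by rewrite -xk addrC subrK.
by rewrite -addrA natr1 !(labels_spokeless _ pm n4 ME) step_residue.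
Qed.

Lemma labelsK M : M \in M2 n -> matching_of (labels M) = M.
Proof.
move=> MM2; have /forallP lv := valid_labels MM2.
have /M2P[/(perfect_matching_degree _ n_gt2 n_neq4)[ME deg_u deg_v] _] := MM2.
(* A spoke at [i] excludes [uu i], [vv i] and [vv (i - 1)], so the arc into [i] can only be
   [2 -> 0]; conversely, this arc leaves only the spoke to cover [v i]. *)
have spokeE i : label_spoke (labels M) i = (spoke i \in M).
  have := lv (i - 1); rewrite subrK /label_spoke !ffunE.
  have := deg_u i; have := deg_v i.
  by case: (uu i \in M); case: (vv i \in M); case: (uu (i - 1) \in M);
    case: (vv (i - 1) \in M); case: (spoke i \in M); case: (uu (i - 2) \in M).
have mem A : A \in petersen2 n -> (A \in matching_of (labels M)) = (A \in M).
  move=> /petersen2P[[i ->]|[[i ->]|[i ->]]].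
  - by rewrite matching_of_uu ffunE.
  - by rewrite matching_of_spoke spokeE.
  - by rewrite matching_of_vv ffunE.
apply/setP => A; case: (boolP (A \in petersen2 n)) => [/mem //|AE].
by rewrite (contraNF (subsetP ME A) AE) (contraNF (subsetP (matching_of_sub _) A) AE).
Qed.

(** [matching_of] maps the valid labellings bijectively onto [M2 n], with inverse [labels]; the
    occurrence of an arc [2 -> 0] decides between the two types. *)
Lemma card_M2 : #|M2 n| = #|[set f : {ffun 'Z_n -> bool * bool} | valid f]|.
Proof.
rewrite -(card_imset _ (can_inj matching_ofK)); apply: eq_card => M.
apply/idP/imsetP => [MM2|[f]].
  by exists (labels M); rewrite ?labelsK // inE valid_labels.
rewrite inE => fv ->; rewrite inE perfect_matching_of //= (negPf n_neq4).
case: (pickP (label_spoke f)) => [i si|ns].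
  by rewrite (spoke_type_matching_of fv si).
by rewrite spokeless_type_matching_of ?orbT // => i; rewrite ns.
Qed.
End Labels.

(** * The exceptional case [n = 4], and the final count *)

Lemma card_M2_4 : #|M2 4| = 1%N.
Proof.
pose M0 : {set {set vertex 4}} :=
  [set [set u 0; u 2]; [set u 1; u 3]; [set v 1; v 2]; [set v 3; v 0]].
apply: (@eq_card1 _ M0) => M; rewrite !inE /=; apply: andb_idl => /eqP -> {M}.
rewrite perfect_matchingE; apply/andP; split.
  apply/subsetP => A AM; apply/petersen2P; move: AM.
  rewrite !inE -!orbA => /or4P[] /eqP ->.
  - by left; exists 0; rewrite /uu add0r.
  - by left; exists 1; congr [set _; u _]; apply: val_inj.
  - by right; right; exists 1; congr [set _; v _]; apply: val_inj.
  - by right; right; exists 3; congr [set _; v _]; apply: val_inj.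
have deg x A : A \in M0 -> x \in A -> (forall B, B \in M0 -> x \in B -> B = A) ->
    #|[set B in M0 | x \in B]| == 1%N.
  move=> AM xA uniqA; apply/cards1P; exists A; apply/setP => B; rewrite in_set in_set1.
  by apply/andP/eqP => [[/uniqA]|->] //; apply.
by apply/forallP => -[] [[|[|[|[|//]]]] ltm];
  (* The edges covering [u 0] to [u 3], then [v 0] to [v 3]. *)
  [ apply: (deg _ [set u 0; u 2]) | apply: (deg _ [set u 1; u 3])
  | apply: (deg _ [set u 0; u 2]) | apply: (deg _ [set u 1; u 3])
  | apply: (deg _ [set v 3; v 0]) | apply: (deg _ [set v 1; v 2])
  | apply: (deg _ [set v 1; v 2]) | apply: (deg _ [set v 3; v 0]) ];
  rewrite ?inE ?eqxx ?orbT // => B; rewrite !inE -!orbA => /or4P[] /eqP -> //;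
  rewrite !inE.
Qed.

Theorem theorem2p2 (n : nat) (hn : (3 <= n)%N) :
  #|M2 n|%:R =
    (if (n == 4)%N then 1
     else \sum_(0 <= l < (n %/ 3).+1 | (n - 3 * l == 0 %[mod 4])%N)
            n%:R / (l + (n - 3 * l) %/ 4)%:R
              * 'C(l + (n - 3 * l) %/ 4, l)%:R) :> rat.
Proof.
case: (eqVneq n 4) => [->|n_neq4]; first by rewrite card_M2_4.
rewrite tiling_sumE ?tiling_sum_closed_walks ?card_M2 //; try lia.
(* Once [n] has the form [m.+2], ['Z_n] reduces to ['I_m.+2], the index type of
   [card_closed_walks]. *)
case: n hn n_neq4 => [|[|n]] // _ _; congr _%:R; exact: card_closed_walks.
Qed.
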